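(* Let $\mathbb{K}\in\{\mathbb{R},\mathbb{C}\}$ and let $\mathcal{X}$ be a separable topological $\mathbb{K}$-vector space whose topological dual $\mathcal{X}^{\ast}$ separates the points of $\mathcal{X}$ and which is a Gateaux-differentiability space. Then for every $0$-neighborhood $\mathcal{U}$ in $\mathcal{X}$, the set $\mathcal{D}_{\mathcal{U}}$ is a $G_\delta$ subset of $\mathbf{CU}_{\mathcal{U}}(\mathcal{X}^{\ast})$ endowed with the weak*-Hausdorff hypertopology.
   Context: Topological vector spaces are Hausdorff; $\mathcal{X}^{\ast}$ carries the weak* topology. $\mathcal{X}$ is a Gateaux-differentiability space if every continuous convex real-valued function whose domain is a nonempty open convex subset of $\mathcal{X}$ is Gateaux-differentiable on a dense subset of that domain. $\mathcal{U}^{\circ}=\{\sigma\in\mathcal{X}^{\ast}:|\sigma(A)|\le1\ \forall A\in\mathcal{U}\}$; $\mathbf{CU}_{\mathcal{U}}(\mathcal{X}^{\ast})$ is the set of nonempty convex weak*-closed subsets of $\mathcal{U}^{\circ}$; $\mathcal{D}_{\mathcal{U}}=\{U\in\mathbf{CU}_{\mathcal{U}}(\mathcal{X}^{\ast}):U=\overline{\mathcal{E}(U)}\}$, where $\mathcal{E}(U)$ is the set of extreme points of $U$ and the closure is weak*. The weak*-Hausdorff hypertopology is generated by the extended pseudometrics $d_H^{(A)}(F,\tilde F)=\max\{\sup_{\sigma\in F}\inf_{\tilde\sigma\in\tilde F}|(\sigma-\tilde\sigma)(A)|,\ \sup_{\tilde\sigma\in\tilde F}\inf_{\sigma\in F}|(\sigma-\tilde\sigma)(A)|\}$,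 $A\in\mathcal{X}$. *)

(* Defs.v *)
From HB Require Import structures.
From mathcomp Require Import all_boot all_order all_algebra.
From mathcomp Require Import all_classical all_reals all_analysis.
From mathcomp Require Import complex.
Set Implicit Arguments.
Unset Strict Implicit.
Unset Printing Implicit Defensive.
Import Order.TTheory GRing.Theory Num.Theory.
Import numFieldNormedType.Exports.
Local Open Scope classical_set_scope.
Local Open Scope ring_scope.

(* Everything below is generic in:
   - R : realType (the reals),
   - K : numFieldType (the scalar field, K = R or K = C := R[i]),
   - nrm : K -> R, the absolute value of K with values in R,
   - emb : R -> K, the embedding of the reals into K,
   - X : a topological K-vector space (continuous +, -, scaling).
   The theorem instantiates (K, nrm, emb) with (R, normr, id) and
   (R[i], fun z => Re `|z|, fun r => r%:C). *)

Section Gen.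
Variables (R : realType) (K : numFieldType) (nrm : K -> R) (emb : R -> K).
Variable X : topologicalLmodType K.

Definition dual : set (X -> K) :=
  [set s | (forall (a : K) (x y : X), s (a *: x + y) = a * s x + s y)
           /\ continuous (s : X -> K)].

Definition dual_separates : Prop :=
  forall x y : X, x <> y -> exists2 s, dual s & s x <> s y.

Definition separable : Prop :=
  exists S : set X, countable S /\ dense S.

Definition convex_set_X (D : set X) : Prop :=
  forall x y, D x -> D y -> forall t : R, 0 <= t <= 1 ->
    D (emb t *: x + emb (1 - t) *: y).

Definition convex_fun_on (D : set X) (f : X -> R) : Prop :=
  forall x y, D x -> D y -> forall t : R, 0 <= t <= 1 ->
    f (emb t *: x + emb (1 - t) *: y) <= t * f x + (1 - t) * f y.

Definition gateaux_diff_at (f : X -> R) (x : X) : Prop :=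
  exists L : X -> R,
    (forall (a : R) (h k : X), L (emb a *: h + k) = a * L h + L k) /\
    continuous L /\
    forall h : X,
      (fun t : R => t^-1 * (f (x + emb t *: h) - f x)) @ 0^' --> L h.

Definition gateaux_diff_space : Prop :=
  forall (D : set X) (f : X -> R),
    D !=set0 -> open D -> convex_set_X D ->
    {within D, continuous f} -> convex_fun_on D f ->
    D `<=` closure [set x | D x /\ gateaux_diff_at f x].

(* weak* topology: subspace topology of X^* in the topology of pointwise
   convergence on functions X -> K *)
Definition wstar_closure (S : set (X -> K)) : set (X -> K) :=
  (@closure {ptws X -> K} S) `&` dual.

Definition wstar_closed (F : set (X -> K)) : Prop :=
  F `<=` dual /\ wstar_closure F `<=` F.

Definition polar (U : set X) : set (X -> K) :=
  [set s | dual s /\ forall A, U A -> nrm (s A) <= 1].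

Definition convex_set_dual (F : set (X -> K)) : Prop :=
  forall s1 s2, F s1 -> F s2 -> forall t : R, 0 <= t <= 1 ->
    F (fun x => emb t * s1 x + emb (1 - t) * s2 x).

Definition CU (U : set X) : set (set (X -> K)) :=
  [set F | F !=set0 /\ convex_set_dual F /\ wstar_closed F /\ F `<=` polar U].

Definition extreme_points (F : set (X -> K)) : set (X -> K) :=
  [set s | F s /\
     forall s1 s2, F s1 -> F s2 -> forall t : R, 0 < t < 1 ->
       s = (fun x => emb t * s1 x + emb (1 - t) * s2 x) -> s1 = s2].

Definition DU (U : set X) : set (set (X -> K)) :=
  [set F | CU U F /\ F = wstar_closure (extreme_points F)].

Definition dH (A : X) (F G : set (X -> K)) : \bar R :=
  maxe (ereal_sup [set ereal_inf [set (nrm (s A - t A))%:E | t in G] | s in F])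
       (ereal_sup [set ereal_inf [set (nrm (s A - t A))%:E | s in F] | t in G]).

(* open subsets of CU_U for the weak*-Hausdorff hypertopology, i.e. the
   topology generated by the family of extended pseudometrics dH A *)
Definition hyper_open (U : set X) (O : set (set (X -> K))) : Prop :=
  O `<=` CU U /\
  forall F, O F -> exists (As : seq X) (e : R), 0 < e /\
    forall G, CU U G -> (forall A, A \in As -> (dH A F G < e%:E)%E) -> O G.

Definition hyper_Gdelta (U : set X) (S : set (set (X -> K))) : Prop :=
  exists O : nat -> set (set (X -> K)),
    (forall n, hyper_open U (O n)) /\ S = \bigcap_n O n.

End Gen.

Definition thm_for (R : realType) (K : numFieldType) (nrm : K -> R)
    (emb : R -> K) : Prop :=
  forall X : topologicalLmodType K,
    hausdorff_space X ->
    separable X -> dual_separates X -> gateaux_diff_space emb X ->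
    forall U : set X, nbhs (0 : X) U ->
      hyper_Gdelta nrm emb U (DU nrm emb U).

(* Main.v *)
Require Import Defs.
From HB Require Import structures.
From mathcomp Require Import all_boot all_order all_algebra.
From mathcomp Require Import all_classical all_reals all_analysis.
From mathcomp Require Import complex.
From mathcomp Require Import ring lra.
Set Implicit Arguments.
Unset Strict Implicit.
Unset Printing Implicit Defensive.
Import Order.TTheory GRing.Theory Num.Theory.
Import numFieldNormedType.Exports.
Local Open Scope classical_set_scope.
Local Open Scope ring_scope.

(** Pair functionals with points through [re (s A)]. On [CU U] the
   hypertopology is that of pointwise convergence of support functions, so by
   Hahn-Banach and compactness of the polar of [U], "[F] is contained in the
   open set [O]" is an open condition on [F].

   Slices of a compact convex [F] form a neighborhood base at each extreme
   point. Conversely each slice of [F] contains an extreme point: the support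
   function of [F] is Gateaux-differentiable at points arbitrarily close to the
   direction of the slice, and at such a point it has exactly one maximiser in
   [F]. Hence the extreme points are dense in [F] if and only if, for every [n],
   [F] is covered by finitely many sets of size [1/n] (measured on the first
   [n] terms of a dense sequence of the space), each of which contains a slice
   of [F]; for fixed [n] this is an open condition. *)

(** * Compactness and density in topological spaces *)

(** The near-covering form of compactness, taken along the filter of finite lists ordered by
    inclusion. The sets [f i] need only be neighborhoods, which allows side conditions on [i] inside
    them. *)
Lemma compact_subcover (Y : topologicalType) (I : eqType) (C : set Y)
    (f : I -> set Y) :
  compact C -> (forall y, C y -> exists i, nbhs y (f i)) ->
  exists s : seq I, forall y, C y -> exists2 i, i \in s & f i y.
Proof.
move=> /compact_near_coveringP cC Cf.
pose F : set_system (seq I) := [set A | exists s0 : seq I, forall s : seq I,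
  {subset s0 <= s} -> A s].
have FF : Filter F.
  split; first by exists [::].
    move=> P Q [s1 Ps1] [s2 Qs2]; exists (s1 ++ s2) => s s12; split.
      by apply: Ps1 => i si; apply: s12; rewrite mem_cat si.
    by apply: Qs2 => i si; apply: s12; rewrite mem_cat si orbT.
  by move=> P Q PQ [s Ps]; exists s => ? /Ps /PQ.
have [|s sC] := cC _ F (fun s y => exists2 i, i \in s & f i y) FF; last first.
  by exists s => y Cy; exact: sC.
move=> y /Cf[i fi]; exists (f i, [set s : seq I | i \in s]); last first.
  by move=> [z s] /= [fiz si]; exists i.
by split => //=; exists [:: i] => s; apply; rewrite mem_head.
Qed.

(* The weights come from the point of [C] minimising a finite sum of squares of
   the [f i] that does not vanish on [C]. *)
Lemma compact_separation (R : realType) (Y : topologicalType) (I : eqType)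
    (C : set Y) (f : I -> Y -> R) :
  compact C -> (forall i, continuous (f i)) ->
  (forall y z t, C y -> C z -> 0 < t <= 1 ->
    exists2 x, C x & forall i, f i x = (1 - t) * f i y + t * f i z) ->
  (forall y, C y -> exists i, f i y != 0) ->
  exists (s : seq I) (w : I -> R),
    forall y, C y -> 1 <= \sum_(i <- s) w i * f i y.
Proof.
move=> cC cf convC nzC.
have [->|/set0P C0] := eqVneq C set0; first by exists [::], (fun=> 0).
have [s sC] : exists s : seq I, forall y, C y ->
    exists2 i, i \in s & f i y != 0.
  apply: (compact_subcover (f := fun i => [set y | f i y != 0]) cC).
  move=> y /nzC[i fi0]; exists i.
  by apply: (cf i y [set r | r != 0]); apply: open_nbhs_nbhs; split => //;
    exact: open_neq.
pose g y : R := \sum_(i <- s) f i y ^+ 2.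
have cg : continuous g.
  move=> y; rewrite /g.
  apply: cvg_big => [|i _]; first exact: add_continuous.
  apply: (@cvg_comp _ _ _ (f i) (fun r => r ^+ 2)); first exact: cf.
  exact: exprn_continuous.
have [y0 /[!inE] Cy0 y0min] : exists2 c, c \in C &
    forall t, t \in C -> g c <= g t.
  by apply: compact_EVT_min => //; exact: continuous_subspaceT.
have g0 : 0 < g y0.
  have [i iD fi0] := sC _ Cy0.
  rewrite /g (big_rem i)//= ltr_wpDr ?exprn_even_gt0//.
  by apply: sumr_ge0 => j _; exact: sqr_ge0.
exists s, (fun i => (g y0)^-1 * f i y0) => z Cz.
under eq_bigr do rewrite -mulrA.
rewrite -mulr_sumr ler_pdivlMl// mulr1.
pose a := \sum_(i <- s) f i y0 * f i z.
pose b := \sum_(i <- s) (f i y0 - f i z) ^+ 2.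
have b0 : 0 <= b by apply: sumr_ge0 => i _; exact: sqr_ge0.
rewrite -/a leNgt; apply/negP => ag.
(* First variation of [g] at its minimiser [y0] in the direction of [z], after division by [t]. *)
have key t : 0 < t <= 1 -> 0 <= - 2 * (g y0 - a) + t * b.
  move=> /andP[t0 t1].
  have [x Cx fx] := convC y0 z t Cy0 Cz (introT andP (conj t0 t1)).
  have := y0min x; rewrite !inE => /(_ Cx).
  rewrite -subr_ge0; suff -> : g x - g y0 = t * (- 2 * (g y0 - a) + t * b).
    by rewrite pmulr_rge0.
  rewrite /g /a /b -!sumrB !mulr_sumr -big_split mulr_sumr /=.
  by apply: eq_bigr => i _; rewrite fx; ring.
(* For this [t] the quadratic term [t * b] is at most [g y0 - a], so [key] fails if [a < g y0]. The
   summand 1 covers [b = 0]. *)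
have t1 : 0 < Num.min 1 ((g y0 - a) / (1 + b)) <= 1.
  rewrite ge_min lexx/= andbT lt_min ltr01/= divr_gt0//; last lra.
  by rewrite subr_gt0.
have := key _ t1.
have : Num.min 1 ((g y0 - a) / (1 + b)) * b <= g y0 - a.
  apply: (@le_trans _ _ ((g y0 - a) / (1 + b) * b)).
    by rewrite ler_wpM2r// ge_min lexx orbT.
  rewrite -mulrA ger_pMr ?subr_gt0// mulrC ler_pdivrMr; lra.
lra.
Qed.

Lemma closure_le (R : realType) (Y : topologicalType) (h : Y -> R) (c : R)
    (S : set Y) (y : Y) :
  continuous h -> (forall z, S z -> h z <= c) -> closure S y -> h y <= c.
Proof.
move=> ch Sc cSy.
have cl : closed [set z | h z <= c].
  by apply: (@closed_comp _ _ h [set r | r <= c]); last exact: closed_le.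
by apply: cl; apply: closure_subset cSy.
Qed.

Lemma dense_sequence (Y : topologicalType) (y0 : Y) (S : set Y) :
  countable S -> dense S ->
  exists a : nat -> Y, forall (y : Y) (B : set Y), nbhs y B ->
    exists j, B (a j).
Proof.
move=> cS dS.
have [f fS] : exists f : Y -> nat, {in S &, injective f}.
  by move/countable_injP : cS => [f]; exists f.
(* Indices that [f] takes at no point of [S] get the default value [y0]. *)
pose a n := xget y0 [set y | S y /\ f y = n].
exists a => y B; rewrite nbhsE => -[V [oV Vy] VB].
have [z [Vz Sz]] := dS V (ex_intro _ y Vy) oV.
exists (f z); apply: VB.
have [Sa fa] : [set y | S y /\ f y = f z] (a (f z)) by apply: xgetPex; exists z.
by rewrite (fS (a (f z)) z) ?inE.
Qed.

(** * The scalar field and its real part *)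

Section WeakStar.
Variables (R : realType) (K : numFieldType) (nrm : K -> R) (emb : R -> K).
Variables (re : K -> R) (J iota : K).
Hypothesis emb1 : emb 1 = 1.
Hypothesis embD : forall a b, emb (a + b) = emb a + emb b.
Hypothesis embM : forall a b, emb (a * b) = emb a * emb b.
Hypothesis emb_le : forall a b, (emb a <= emb b) = (a <= b).
Hypothesis emb_nrm : forall k, emb (nrm k) = `|k|.
Hypothesis reD : forall k l, re (k + l) = re k + re l.
Hypothesis reM : forall r k, re (emb r * k) = r * re k.
Hypothesis re_le_nrm : forall k, `|re k| <= nrm k.
(* For [R[i]], [iota] is the imaginary unit and [J = - iota], so that
   [re (J * k)] is the imaginary part of [k]; for the reals, [iota = J = 0]. *)
Hypothesis reE : forall k, k = emb (re k) + iota * emb (re (J * k)).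

Lemma emb0 : emb 0 = 0.
Proof. by apply: (addrI (emb 0)); rewrite -embD !addr0. Qed.

Lemma embN a : emb (- a) = - emb a.
Proof. by apply: (addrI (emb a)); rewrite -embD !subrr emb0. Qed.

Lemma emb_inj : injective emb.
Proof. by move=> a b ab; apply/eqP; rewrite eq_le -!emb_le ab lexx. Qed.

Lemma emb_lt a b : (emb a < emb b) = (a < b).
Proof. by rewrite !lt_neqAle emb_le (inj_eq emb_inj). Qed.

Lemma nrm_ge0 k : 0 <= nrm k.
Proof. by rewrite -emb_le emb0 emb_nrm. Qed.

Lemma nrm0 : nrm 0 = 0.
Proof. by apply: emb_inj; rewrite emb_nrm normr0 emb0. Qed.

Lemma nrm_gt0 k : (0 < nrm k) = (k != 0).
Proof. by rewrite -emb_lt emb0 emb_nrm normr_gt0. Qed.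

Lemma nrmD k l : nrm (k + l) <= nrm k + nrm l.
Proof. by rewrite -emb_le embD !emb_nrm ler_normD. Qed.

Lemma nrmM k l : nrm (k * l) = nrm k * nrm l.
Proof. by apply: emb_inj; rewrite embM !emb_nrm normrM. Qed.

Lemma nrmC k l : nrm (k - l) = nrm (l - k).
Proof. by apply: emb_inj; rewrite !emb_nrm distrC. Qed.

Lemma nrm_emb r : 0 <= r -> nrm (emb r) = r.
Proof.
by move=> r0; apply: emb_inj; rewrite emb_nrm ger0_norm// -emb0 emb_le.
Qed.

Lemma re0 : re 0 = 0.
Proof. by rewrite -(mul0r (0 : K)) -emb0 reM mul0r. Qed.

Lemma reN k : re (- k) = - re k.
Proof. by apply: (addrI (re k)); rewrite -reD !subrr re0. Qed.

Lemma nrm_lipschitz_continuous (g : K -> R) :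
  (forall k l, `|g k - g l| <= nrm (k - l)) -> continuous g.
Proof.
move=> glip k; apply/(@cvgrPdist_lt _ _ _ _ (nbhs_filter k)) => e e0.
near=> l.
apply: le_lt_trans (glip _ _) _; rewrite -emb_lt emb_nrm; near: l.
by exists (emb e) => //=; rewrite -emb0 emb_lt.
Unshelve. all: by end_near. Qed.

Lemma re_continuous : continuous re.
Proof. by apply: nrm_lipschitz_continuous => k l; rewrite -reN -reD. Qed.

Lemma nrm_continuous : continuous nrm.
Proof.
apply: nrm_lipschitz_continuous => k l; rewrite ler_norml.
have := nrmD (k - l) l; have := nrmD (l - k) k.
by rewrite !subrK [nrm (l - k)]nrmC => ? ?; apply/andP; split; lra.
Qed.

Lemma emb_continuous : continuous emb.
Proof.
have norm_emb r : `|emb r| = emb `|r|.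
  have [r0|r0] := leP 0 r; first by rewrite -emb_nrm nrm_emb// ger0_norm.
  by rewrite -normrN -embN -emb_nrm nrm_emb ?ltr0_norm// oppr_ge0 ltW.
move=> x; apply/(@cvgrPdist_lt _ K _ _ (nbhs_filter x)) => e e0.
have e0' : 0 < nrm e by rewrite nrm_gt0 gt_eqF.
near=> y; rewrite -embN -embD norm_emb -(gtr0_norm e0) -emb_nrm emb_lt.
by near: y; apply: cvgr_dist_lt e0' => //; exact: cvg_id.
Unshelve. all: by end_near. Qed.

(** By [reE] the disc is a closed subset of the continuous image of a compact rectangle of real
    coordinates. *)
Lemma disc_compact r : compact [set k | nrm k <= r].
Proof.
pose f (z : R * R) : K := emb z.1 + iota * emb z.2.
have cf : continuous f.
  have c2 : continuous (fun z : R * R => emb z.2).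
    move=> z; apply: (@continuous_comp _ _ _ (fun z : R * R => z.2) emb).
      exact: cvg_snd.
    exact: emb_continuous.
  move=> z; apply: (@cvgD K K _ (nbhs z) _ (fun z : R * R => emb z.1)
    (fun z : R * R => iota * emb z.2) (emb z.1) (iota * emb z.2)).
    apply: (@continuous_comp _ _ _ (fun z : R * R => z.1) emb).
      exact: cvg_fst.
    exact: emb_continuous.
  apply: (@cvgM K _ (nbhs z) _ (fun=> iota) (fun z : R * R => emb z.2) iota
    (emb z.2)); [exact: cvg_cst|exact: c2].
pose C : set (R * R) := `[- r, r] `*` `[- (nrm J * r), nrm J * r].
have cC : compact C by apply: compact_setX; exact: segment_compact.
apply: (@subclosed_compact _ _ (f @` C)).
- apply: (@closed_comp _ _ nrm [set y | y <= r]); last exact: closed_le.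
  by move=> k _; exact: nrm_continuous.
- by apply: continuous_compact => //; exact: continuous_subspaceT.
- move=> k /= kr; exists (re k, re (J * k)); last by rewrite /f /= -reE.
  split => /=; rewrite in_itv/= -ler_norml;
    apply: le_trans (re_le_nrm _) _ => //.
  by rewrite nrmM ler_wpM2l// nrm_ge0.
Qed.

Variable X : topologicalLmodType K.
Local Notation T := {ptws X -> K}.
Local Notation dual := (@dual K X).
Local Notation polar := (@polar R K nrm X).
Local Notation CU := (@CU R K nrm emb X).
Local Notation extreme_points := (@extreme_points R K emb X).

(** * Polars in the pointwise topology *)

Lemma eval_continuous (A : X) : continuous (fun s : T => s A).
Proof. exact: (@proj_continuous X (fun=> K) A). Qed.

Lemma re_eval_continuous (A : X) : continuous (fun s : T => re (s A)).
Proof.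
move=> s; apply: (@continuous_comp _ _ _ (fun s : T => s A) re).
  exact: eval_continuous.
exact: re_continuous.
Qed.

Lemma nrm_eval_continuous (e : K) (A : X) :
  continuous (fun s : T => nrm (s A - e)).
Proof.
move=> s; apply: (@continuous_comp _ _ _ (fun s : T => s A - e) nrm).
  apply: (@cvgB K K T (nbhs s) _ (fun s => s A) (fun=> e) (s A) e).
    exact: eval_continuous.
  exact: cvg_cst.
exact: nrm_continuous.
Qed.

Lemma dualD s x y : dual s -> s (x + y) = s x + s y.
Proof. by move=> [lin _]; have := lin 1 x y; rewrite scale1r mul1r. Qed.

Lemma dual0 s : dual s -> s 0 = 0.
Proof. by move=> ds; apply: (addrI (s 0)); rewrite -dualD// !addr0. Qed.

Lemma dualZ s k x : dual s -> s (k *: x) = k * s x.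
Proof. by move=> ds; have := ds.1 k x 0; rewrite !addr0 dual0// addr0. Qed.

Lemma dualB s x y : dual s -> s (x - y) = s x - s y.
Proof. by move=> ds; rewrite dualD// -scaleN1r dualZ// mulN1r. Qed.

Lemma re_dualN s x : dual s -> re (s (- x)) = - re (s x).
Proof. by move=> ds; rewrite -scaleN1r dualZ// mulN1r reN. Qed.

Lemma re_dual_sum (s : X -> K) (q : seq X) (w : X -> R) : dual s ->
  re (s (\sum_(x <- q) emb (w x) *: x)) = \sum_(x <- q) w x * re (s x).
Proof.
move=> ds; elim: q => [|x q IH]; first by rewrite !big_nil dual0// re0.
by rewrite !big_cons dualD// reD IH dualZ// reM.
Qed.

(** A functional is determined by its real part: by [reE], its value at [A] is recovered from the
    real parts at [A] and at [J *: A]. *)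
Lemma re_dual_neq s t : dual s -> dual t -> s <> t ->
  exists A, re (s A) != re (t A).
Proof.
move=> ds dt st; apply: contrapT => /forallNP eqre; apply: st.
have {}eqre A : re (s A - t A) = 0.
  by rewrite reD reN; have /negP/negPn/eqP -> := eqre A; rewrite subrr.
apply: funext => A; apply/eqP; rewrite -subr_eq0 [_ - _]reE eqre.
by rewrite mulrBr -!dualZ// eqre emb0 mulr0 addr0.
Qed.

Lemma nbhs_scaled (U : set X) (x : X) (r : R) :
  nbhs 0 U -> nbhs x [set y | U (emb r *: (y - x))].
Proof.
move=> U0.
have : continuous (fun y : X => emb r *: (y - x)).
  move=> y; apply: (@continuous_comp X (K^o * X)%type X
    (fun y => (emb r : K^o, y - x)) (fun z => z.1 *: z.2)).
    apply: (@cvg_pair _ _ _ _ (nbhs (emb r : K^o))) => /=.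
      exact: cvg_cst.
    apply: (@continuous_comp X (X * X)%type X (fun y => (y, x))
      (fun z => z.1 - z.2)); last exact: sub_continuous.
    by apply: cvg_pair; [exact: cvg_id|exact: cvg_cst].
  exact: scale_continuous.
by apply; rewrite subrr scaler0.
Qed.

Lemma absorbing (U : set X) (x : X) :
  nbhs 0 U -> exists2 r : R, 0 < r & U (emb r *: x).
Proof.
move=> U0.
have cx : (fun r : R => emb r *: x) @ nbhs 0 --> (0 : X).
  rewrite -[X in _ --> X](scale0r x) -emb0.
  apply: (@continuous_comp R (K^o * X)%type X
    (fun r => (emb r : K^o, x)) (fun z => z.1 *: z.2)).
    apply: (@cvg_pair _ _ _ _ (nbhs (emb 0 : K^o))) => /=.
      exact: emb_continuous.
    exact: cvg_cst.
  exact: scale_continuous.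
have : \forall r \near (0 : R)^'+, U (emb r *: x).
  by apply: cvg_at_right_filter cx _ U0.
move=> Ur; near (0 : R)^'+ => r; exists r.
  by near: r; exact: nbhs_right_gt.
by near: r.
Unshelve. all: by end_near. Qed.

(** Equicontinuity of the polar: the bound does not depend on [s]. *)
Lemma polar_close (U : set X) (s : X -> K) (r : R) (x y : X) :
  polar U s -> 0 < r -> U (emb r *: (y - x)) -> nrm (s y - s x) <= r^-1.
Proof.
move=> [ds sU] r0 /sU; rewrite dualZ// nrmM (nrm_emb (ltW r0)) dualB//.
by rewrite -ler_pdivlMl// mulr1.
Qed.

Lemma linear_polar (U : set X) (s : X -> K) : nbhs 0 U ->
  (forall a x y, s (a *: x + y) = a * s x + s y) ->
  (forall A, U A -> nrm (s A) <= 1) -> polar U s.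
Proof.
move=> U0 lin sU; split => //; split => // x; apply/cvgrPdist_lt => e e0.
have e0' : 0 < nrm e by rewrite nrm_gt0 gt_eqF.
have := nbhs_scaled x (2 / nrm e) U0; apply: filterS => y /sU.
have sZ k z : s (k *: z) = k * s z.
  have s0 : s 0 = 0.
    by apply: (addrI (s 0)); have := lin 1 0 0; rewrite scale1r mul1r !addr0.
  by have := lin k z 0; rewrite !addr0 s0 addr0.
rewrite sZ nrmM nrm_emb ?divr_ge0 ?(ltW e0')//.
rewrite addrC -scaleN1r lin mulN1r addrC => sle.
rewrite -(gtr0_norm e0) -!emb_nrm emb_lt nrmC.
by have : nrm (s y - s x) <= nrm e / 2;
  [move: sle; rewrite -ler_pdivlMl ?divr_gt0// mulr1 invf_div|lra].
Qed.

(** Linearity and the bound on [U] pass to pointwise limits; continuity of the limit then follows by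
    [linear_polar]. *)
Lemma polar_closed (U : set X) : nbhs 0 U -> closed (polar U : set T).
Proof.
move=> U0 s cs; apply: linear_polar => // [a x y|A UA]; last first.
  apply: (@closure_le _ T (fun s => nrm (s A)) _ _ s _ _ cs).
    move=> t; apply: (@continuous_comp _ _ _ (fun s : T => s A) nrm).
      exact: eval_continuous.
    exact: nrm_continuous.
  by move=> t [_]; apply.
apply/eqP; rewrite -subr_eq0 -[_ == _]negbK -nrm_gt0 -leNgt.
apply: (@closure_le _ T (fun s => nrm (s (a *: x + y) - (a * s x + s y)))
  _ _ s _ _ cs).
  move=> t; apply: (@continuous_comp _ _ _
    (fun s : T => s (a *: x + y) - (a * s x + s y)) nrm); last first.
    exact: nrm_continuous.
  apply: (@cvgB K K T (nbhs t) _ (fun s => s (a *: x + y))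
    (fun s => a * s x + s y) (t (a *: x + y)) (a * t x + t y)).
    exact: eval_continuous.
  apply: (@cvgD K K T (nbhs t) _ (fun s => a * s x) (fun s => s y)
    (a * t x) (t y)); last exact: eval_continuous.
  apply: (@cvgM K T (nbhs t) _ (fun=> a) (fun s => s x) a (t x)).
    exact: cvg_cst.
  exact: eval_continuous.
by move=> t [[-> _] _]; rewrite subrr leNgt nrm_gt0 eqxx.
Qed.

(** Banach-Alaoglu: since [U] is absorbing, the polar is a closed subset of a product of discs,
    which is compact by Tychonoff. *)
Lemma polar_compact (U : set X) : nbhs 0 U -> compact (polar U : set T).
Proof.
move=> U0.
have /choice[b bP] : forall A : X, exists r : R, 0 < r /\ U (emb r *: A).
  by move=> A; have [r r0 Ur] := absorbing A U0; exists r.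
apply: (@subclosed_compact _ _ [set s : T | forall A, nrm (s A) <= (b A)^-1]).
- exact: polar_closed.
- apply: (@tychonoff X (fun=> K) (fun A => [set k | nrm k <= (b A)^-1])) => A.
  exact: disc_compact.
- move=> s Us A; have [b0 UbA] := bP A.
  have := @polar_close U s (b A) 0 A Us b0.
  rewrite subr0 dual0; last by case: Us.
  by rewrite subr0; exact.
Qed.


Lemma CU_closed (U : set X) (F : set T) : nbhs 0 U -> CU U F -> closed F.
Proof.
move=> U0 [_ [_ [[_ cF] Fpol]]] s cs; apply: cF; split => //.
have [//] : polar U s.
by apply: (polar_closed U0); apply: closure_subset cs.
Qed.

Lemma CU_compact (U : set X) (F : set T) : nbhs 0 U -> CU U F -> compact F.
Proof.
move=> U0 CF; apply: subclosed_compact (polar_compact U0) _.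
  exact: CU_closed CF.
by have [_ [_ []]] := CF.
Qed.

Lemma CU_dual (U : set X) (F : set T) s : CU U F -> F s -> dual s.
Proof. by move=> [_ [_ [[Fdual _] _]]] /Fdual. Qed.

Lemma CU_polar (U : set X) (F : set T) s : CU U F -> F s -> polar U s.
Proof. by move=> [_ [_ [_ Fpol]]] /Fpol. Qed.

Lemma re_mix (t : R) k l :
  re (emb t * k + emb (1 - t) * l) = t * re k + (1 - t) * re l.
Proof. by rewrite reD !reM. Qed.

(** The functions [re (t A) - re (s A)] of [s] have no common zero on [F]. The weights given by
    [compact_separation] combine finitely many points [A] into the separating one. *)
Lemma CU_separation (U : set X) (F : set T) (t : X -> K) :
  nbhs 0 U -> CU U F -> dual t -> ~ F t ->
  exists A, forall s, F s -> re (s A) + 1 <= re (t A).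
Proof.
move=> U0 CF dt Ft.
have [||||q [w qw]] := @compact_separation R T X F
    (fun A s => re (t A) - re (s A)).
- exact: CU_compact CF.
- move=> A s; apply: (@cvgB R R T (nbhs s) _ (fun=> re (t A))
    (fun s => re (s A))); first exact: cvg_cst.
  exact: re_eval_continuous.
- move=> y z r Fy Fz /andP[r0 r1]; have [_ [convF _]] := CF.
  exists (fun x => emb (1 - r) * y x + emb (1 - (1 - r)) * z x).
    by apply: convF => //; apply/andP; split; lra.
  by move=> A; rewrite re_mix; ring.
- move=> s Fs; have [|A neA] := @re_dual_neq t s dt (CU_dual CF Fs).
    by move=> ts; apply: Ft; rewrite ts.
  by exists A; rewrite subr_eq0.
exists (\sum_(x <- q) emb (w x) *: x) => s Fs; have := qw s Fs.
rewrite !re_dual_sum//; last exact: (CU_dual CF Fs).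
under eq_bigr do rewrite mulrBr.
by rewrite sumrB; lra.
Qed.

(** * The weak*-Hausdorff hypertopology *)

(** The local clause of [hyper_open], isolated so that finitely many such conditions can be
    intersected. *)
Definition hyper_near (U : set X) (F : set T) (P : set T -> Prop) : Prop :=
  exists (As : seq X) (e : R), 0 < e /\
    forall G, CU U G -> (forall A, A \in As -> (dH nrm A F G < e%:E)%E) -> P G.

Lemma hyper_nearI (U : set X) (F : set T) P Q :
  hyper_near U F P -> hyper_near U F Q ->
  hyper_near U F (fun G => P G /\ Q G).
Proof.
move=> [As [e [e0 PAs]]] [Bs [d [d0 QBs]]].
exists (As ++ Bs), (Num.min e d); split; first by rewrite lt_min e0.
move=> G CG dG; split.
  apply: PAs => // A AAs; apply: lt_le_trans (dG A _) _.
    by rewrite mem_cat AAs.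
  by rewrite lee_fin ge_min lexx.
apply: QBs => // A AAs; apply: lt_le_trans (dG A _) _.
  by rewrite mem_cat AAs orbT.
by rewrite lee_fin ge_min lexx orbT.
Qed.

Lemma hyper_near_seq (U : set X) (F : set T) (I : eqType) (L : seq I)
    (P : I -> set T -> Prop) :
  (forall i, i \in L -> hyper_near U F (P i)) ->
  hyper_near U F (fun G => forall i, i \in L -> P i G).
Proof.
elim: L => [|i L IH] nearP; first by exists [::], 1; split.
have [|As [e [e0 nr]]] := hyper_nearI (nearP i (mem_head _ _)) (IH _).
  by move=> j jL; apply: nearP; rewrite in_cons jL orbT.
exists As, e; split => // G CG dG j.
have [PG PLG] := nr G CG dG.
by rewrite in_cons => /predU1P[->//|]; exact: PLG.
Qed.

Lemma dH_close_l (A : X) (F G : set T) (e : R) s : (dH nrm A F G < e%:E)%E ->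
  F s -> exists2 t, G t & nrm (s A - t A) < e.
Proof.
rewrite gt_max => /andP[ltF _] Fs.
have : (ereal_inf [set (nrm (s A - t A))%:E | t in G] < e%:E)%E.
  by apply: le_lt_trans ltF; apply: ereal_sup_ubound; exists s.
by move=> /ereal_inf_lt[_ [t Gt <-]]; rewrite lte_fin => ?; exists t.
Qed.

Lemma dH_close_r (A : X) (F G : set T) (e : R) t : (dH nrm A F G < e%:E)%E ->
  G t -> exists2 s, F s & nrm (s A - t A) < e.
Proof.
rewrite gt_max => /andP[_ ltG] Gt.
have : (ereal_inf [set (nrm (s A - t A))%:E | s in F] < e%:E)%E.
  by apply: le_lt_trans ltG; apply: ereal_sup_ubound; exists t.
by move=> /ereal_inf_lt[_ [s Fs <-]]; rewrite lte_fin => ?; exists s.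
Qed.

Lemma re_close k l e : nrm (k - l) < e -> re l < re k + e /\ re k < re l + e.
Proof.
move=> kl; have := re_le_nrm (k - l); rewrite reD reN ler_norml => /andP[? ?].
by split; lra.
Qed.

Lemma hyper_near_meet (U : set X) (F : set T) (A : X) (c : R) s :
  F s -> c < re (s A) ->
  hyper_near U F (fun G => exists2 t, G t & c < re (t A)).
Proof.
move=> Fs cs; exists [:: A], (re (s A) - c); split; first by rewrite subr_gt0.
move=> G CG /(_ A (mem_head _ _)) dFG.
have [t Gt /re_close[_ st]] := dH_close_l dFG Fs.
by exists t => //; lra.
Qed.

Lemma hyper_near_subset (U : set X) (F O : set T) :
  nbhs 0 U -> CU U F -> open O -> F `<=` O ->
  hyper_near U F (fun G => G `<=` O).
Proof.
move=> U0 CF oO FO.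
(* The gap 1 from [CU_separation] is split in two: one half leaves room for a neighborhood of [t],
   the other absorbs a Hausdorff distance below 1/2. *)
pose f (i : X * R) : set T :=
  [set t | i.2 < re (t i.1) /\ forall s, F s -> re (s i.1) + 2^-1 <= i.2].
have cUO : compact (polar U `&` ~` O : set T).
  by apply: compact_closedI; [exact: polar_compact|exact: open_closedC].
have [t [Ut Ot]|q qP] := @compact_subcover T (X * R)%type _ f cUO.
  have [A At] := CU_separation U0 CF Ut.1 (fun Ft => Ot (FO _ Ft)).
  exists (A, re (t A) - 2^-1).
  have : open [set s : T | re (t A) - 2^-1 < re (s A)].
    apply: (@open_comp _ _ (fun s : T => re (s A))
      [set r | re (t A) - 2^-1 < r]).
      by move=> s _; exact: re_eval_continuous.
    exact: open_gt.
  move=> oS; have : nbhs (t : T) [set s : T | re (t A) - 2^-1 < re (s A)].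
    by apply: open_nbhs_nbhs; split => //=; lra.
  apply: filterS => s /= ts; split => // k Fk; have := At k Fk; rewrite /=; lra.
exists (map fst q), 2^-1; split => [|G CG dG t Gt]; first by lra.
apply: contrapT => Ot.
have [i iq [it Fi]] := qP t (conj (CU_polar CG Gt) Ot).
have [s Fs /re_close[st _]] := dH_close_r (dG i.1 (map_f fst iq)) Gt.
by have := Fi s Fs; lra.
Qed.

(** * Slices and extreme points *)

Lemma convex_set_halfspace (F : set T) (a : X) (c : R) :
  convex_set_dual emb F -> convex_set_dual emb (F `&` [set s | re (s a) <= c]).
Proof.
move=> convF s t [Fs sc] [Ft tc] r r01; split; first exact: convF.
move: r01 => /andP[r0 r1]; rewrite /= re_mix.
have -> : c = r * c + (1 - r) * c by ring.
by rewrite lerD// ler_wpM2l// subr_ge0.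
Qed.

(** Weights are left unnormalised so that both may vanish, as happens when a point of a join has no
    mass in one of the two pieces. *)
Lemma convex_set_weights (F : set T) (p q : R) s t :
  convex_set_dual emb F -> F s -> F t -> 0 <= p -> 0 <= q ->
  exists2 u, F u & forall A, (p + q) * re (u A) = p * re (s A) + q * re (t A).
Proof.
move=> convF Fs Ft p0 q0; have [pq0|pq0] := eqVneq (p + q) 0.
  exists s => // A; rewrite pq0 mul0r; have -> : p = 0 by lra.
  have -> : q = 0 by lra.
  by rewrite !mul0r addr0.
have pq : 0 < p + q by rewrite lt_neqAle eq_sym pq0 addr_ge0.
exists (fun x => emb (p / (p + q)) * s x + emb (1 - p / (p + q)) * t x).
  apply: convF => //; rewrite divr_ge0 ?addr_ge0//= ler_pdivrMr//.
  by rewrite mul1r lerDl.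
by move=> A; rewrite re_mix; field.
Qed.

(* If no such slice existed, [e] could not be separated from the join of the two
   compact convex pieces of [F] cut off by the half-spaces, so it would lie on
   a segment between them. *)
Lemma extreme_slice_meet (U : set X) (F : set T) e (a b : X) (c d : R) :
  nbhs 0 U -> CU U F -> extreme_points F e -> c < re (e a) -> d < re (e b) ->
  exists A r, r < re (e A) /\
    forall s, F s -> r <= re (s A) -> c < re (s a) /\ d < re (s b).
Proof.
move=> U0 CF [Fe exte] cea deb; have [_ [convF _]] := CF.
pose Fa : set T := F `&` [set s | re (s a) <= c].
pose Fb : set T := F `&` [set s | re (s b) <= d].
have [Fa0|/set0P[s0 Fas0]] := eqVneq Fa set0.
  exists b, ((d + re (e b)) / 2); split => [|s Fs sb]; first by lra.
  split; last by lra.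
  by rewrite ltNge; apply/negP => sc; have : Fa s by []; rewrite Fa0.
have [Fb0|/set0P[t0 Fbt0]] := eqVneq Fb set0.
  exists a, ((c + re (e a)) / 2); split => [|s Fs sa]; first by lra.
  split; first by lra.
  by rewrite ltNge; apply/negP => sc; have : Fb s by []; rewrite Fb0.
have convFa : convex_set_dual emb Fa by exact: convex_set_halfspace.
have convFb : convex_set_dual emb Fb by exact: convex_set_halfspace.
have compact_half (x : X) (r : R) :
    compact (F `&` [set s | re (s x) <= r] : set T).
  apply: compact_closedI; first exact: CU_compact CF.
  apply: (@closed_comp _ _ (fun s : T => re (s x)) [set y | y <= r]).
    by move=> s _; exact: re_eval_continuous.
  exact: closed_le.
(* A triple [(t, s, u)] of [C] stands for the point [(1 - t) s + t u] of the join of [Fa] and [Fb];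
   [f A] compares it with [e] at [A]. *)
pose f A (y : R * T * T) :=
  re (e A) - ((1 - y.1.1) * re (y.1.2 A) + y.1.1 * re (y.2 A)).
pose C : set (R * T * T) := (`[0, 1] `*` Fa) `*` Fb.
have [||||q [w qw]] := @compact_separation R (R * T * T)%type X C f.
- apply: compact_setX; last exact: compact_half.
  by apply: compact_setX; [exact: segment_compact|exact: compact_half].
- move=> A y.
  have c1 : continuous (fun y : R * T * T => y.1.1).
    by move=> z; apply: continuous_comp; exact: cvg_fst.
  have c2 : continuous (fun y : R * T * T => re (y.1.2 A)).
    move=> z; apply: (@continuous_comp _ _ _ (fun y : R * T * T => y.1.2)
      (fun s : T => re (s A))); last exact: re_eval_continuous.
    by apply: continuous_comp; [exact: cvg_fst|exact: cvg_snd].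
  have c3 : continuous (fun y : R * T * T => re (y.2 A)).
    move=> z; apply: (@continuous_comp _ _ _ (fun y : R * T * T => y.2)
      (fun s : T => re (s A))); last exact: re_eval_continuous.
    exact: cvg_snd.
  apply: (@cvgB R R _ (nbhs y) _ (fun=> re (e A)) (fun y : R * T * T =>
    (1 - y.1.1) * re (y.1.2 A) + y.1.1 * re (y.2 A)) (re (e A))
    ((1 - y.1.1) * re (y.1.2 A) + y.1.1 * re (y.2 A))); first exact: cvg_cst.
  apply: (@cvgD R R _ (nbhs y) _ (fun y : R * T * T =>
    (1 - y.1.1) * re (y.1.2 A)) (fun y : R * T * T => y.1.1 * re (y.2 A))
    ((1 - y.1.1) * re (y.1.2 A)) (y.1.1 * re (y.2 A))).
    apply: (@cvgM R _ (nbhs y) _ (fun y : R * T * T => 1 - y.1.1)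
      (fun y : R * T * T => re (y.1.2 A)) (1 - y.1.1) (re (y.1.2 A))).
      apply: (@cvgB R R _ (nbhs y) _ (fun=> 1) (fun y : R * T * T => y.1.1)
        1 y.1.1); [exact: cvg_cst|exact: c1].
    exact: c2.
  apply: (@cvgM R _ (nbhs y) _ (fun y : R * T * T => y.1.1)
    (fun y : R * T * T => re (y.2 A)) y.1.1 (re (y.2 A))); first exact: c1.
  exact: c3.
- move=> [[t1 s1] u1] [[t2 s2] u2] r.
  move=> [[/= t1i Fas1] Fbu1] [[/= t2i Fas2] Fbu2] /andP[r0 r1].
  move: t1i t2i; rewrite !in_itv/= => /andP[t10 t11] /andP[t20 t21].
  (* A mixture of two join points is again one: the masses in [Fa] are collected into [s], those in
     [Fb] into [u]. *)
  have [|||||s Fas sE] :=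
      @convex_set_weights Fa ((1 - r) * (1 - t1)) (r * (1 - t2)) s1 s2 => //.
    by rewrite mulr_ge0 ?subr_ge0.
    by rewrite mulr_ge0 ?subr_ge0// ltW.
  have [|||||u Fbu uE] :=
      @convex_set_weights Fb ((1 - r) * t1) (r * t2) u1 u2 => //.
    by rewrite mulr_ge0 ?subr_ge0.
    by rewrite mulr_ge0 ?subr_ge0// ltW.
  exists ((1 - r) * t1 + r * t2, s, u).
    split => //=; split => //=; rewrite in_itv/=; apply/andP; split.
      by rewrite addr_ge0// mulr_ge0 ?subr_ge0// ltW.
    have : (1 - r) * t1 <= 1 - r by rewrite ler_piMr ?subr_ge0.
    have : r * t2 <= r by rewrite ler_piMr// ltW.
    lra.
  move=> A; rewrite /f/=; have := sE A; have := uE A => -> .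
  have -> : 1 - ((1 - r) * t1 + r * t2) =
    (1 - r) * (1 - t1) + r * (1 - t2) by ring.
  by move=> ->; ring.
(* If every [f A] vanished, [e] would equal the join point. Weight 0 or 1 contradicts the strict
   inequality at [a] or [b]; otherwise extremality gives [s = u], so [e] would satisfy the bound of
   [Fa]. *)
- move=> [[t s] u] [[/= ti [Fs /= sa]] [Fu /= ub]].
  move: ti; rewrite in_itv/= => /andP[t0' t1'].
  apply: contrapT => /forallNP ef.
  have {}ef A : re (e A) = (1 - t) * re (s A) + t * re (u A).
    by have := ef A; rewrite /f/= subr_eq0 => /negP/negPn/eqP.
  have [tz|tnz] := eqVneq t 0.
    by have := ef a; rewrite tz; lra.
  have [t1|tn1] := eqVneq t 1.
    by have := ef b; rewrite t1; lra.
  have su : s = u.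
    apply: (exte s u Fs Fu (1 - t)).
      rewrite subr_gt0 ltrBlDr ltrDl !lt_neqAle tn1 t1' eq_sym tnz t0'.
      by [].
    set m := fun x => _; apply: contrapT => em.
    have Fm : F m.
      by apply: convF => //; rewrite subr_ge0 lerBlDr lerDl t0' t1'.
    have [A] := re_dual_neq (CU_dual CF Fe) (CU_dual CF Fm) em.
    rewrite /m re_mix ef; have -> : 1 - (1 - t) = t by ring.
    by rewrite eqxx.
  by have := ef a; rewrite -su; have := sa; lra.
pose A := \sum_(x <- q) emb (w x) *: x.
have fA y : C y ->
    1 <= re (e A) - ((1 - y.1.1) * re (y.1.2 A) + y.1.1 * re (y.2 A)).
  move=> Cy; apply: le_trans (qw y Cy) _.
  move: Cy => [[_ [Fy1 _]] [Fy2 _]].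
  rewrite /A !re_dual_sum; try exact: CU_dual CF _.
  rewrite !mulr_sumr -big_split/= -sumrB le_eqVlt; apply/orP; left; apply/eqP.
  by apply: eq_bigr => x _; rewrite /f; ring.
(* Points of [Fa] and [Fb] lie in the join with parameter 0 and 1, hence at least 1 below [e] in
   direction [A]; [t0] and [s0] fill the idle coordinate. *)
exists A, (re (e A) - 2^-1); split => [|s Fs sA]; first by lra.
split; rewrite ltNge; apply/negP => sle.
  have /fA/= : C (0, s, t0).
    by split => //; split => //=; rewrite in_itv/= lexx ler01.
  by lra.
have /fA/= : C (1, s0, s).
  by split => //; split => //=; rewrite in_itv/= lexx ler01.
by lra.
Qed.

(** Compactness of the part of [F] outside [O] leaves finitely many half-spaces around [e] to
    satisfy; [extreme_slice_meet] merges them one by one into a single slice. *)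
Lemma extreme_slice (U : set X) (F O : set T) e :
  nbhs 0 U -> CU U F -> extreme_points F e -> open O -> O e ->
  exists A r, r < re (e A) /\ forall s, F s -> r <= re (s A) -> O s.
Proof.
move=> U0 CF exte oO Oe; have [Fe _] := exte.
pose f (i : X * R) : set T := [set s | re (s i.1) < i.2 /\ i.2 < re (e i.1)].
have cFO : compact (F `&` ~` O).
  by apply: compact_closedI; [exact: CU_compact CF|exact: open_closedC].
have [s [Fs Os]|q qP] := @compact_subcover T (X * R)%type _ f cFO.
  have es : s <> e by move=> se; apply: Os; rewrite se.
  have [A ltA] : exists A, re (s A) < re (e A).
    have [A neA] := re_dual_neq (CU_dual CF Fs) (CU_dual CF Fe) es.
    have [?|ge] := ltP (re (s A)) (re (e A)); first by exists A.
    exists (- A); rewrite (re_dualN _ (CU_dual CF Fs)).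
    by rewrite (re_dualN _ (CU_dual CF Fe)) ltrN2 lt_neqAle eq_sym neA.
  exists (A, (re (s A) + re (e A)) / 2).
  have : open [set t : T | re (t A) < (re (s A) + re (e A)) / 2].
    apply: (@open_comp _ _ (fun s : T => re (s A))
      [set r | r < (re (s A) + re (e A)) / 2]); last exact: open_lt.
    by move=> t _; exact: re_eval_continuous.
  move=> oS.
  have : nbhs (s : T) [set t : T | re (t A) < (re (s A) + re (e A)) / 2].
    by apply: open_nbhs_nbhs; split => //=; lra.
  by apply: filterS => t /= ts; split => //=; lra.
suff [A [r [reA slA]]] : exists A r, r < re (e A) /\ forall s, F s ->
    r <= re (s A) -> forall i, i \in q -> i.2 < re (e i.1) -> i.2 < re (s i.1).
  exists A, r; split => // s Fs rs; apply: contrapT => Os.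
  have [i iq [si ie]] := qP s (conj Fs Os).
  by have := slA s Fs rs i iq ie; lra.
elim: q {qP} => [|[a c] q [A [r [reA slA]]]].
  (* In direction 0 at level -1 the slice is all of [F]. *)
  by exists 0, (-1); split => //; rewrite (dual0 (CU_dual CF Fe)) re0 ltrN10.
have [ca|ca] := ltP c (re (e a)); last first.
  exists A, r; split => // s Fs rs i; rewrite in_cons => /predU1P[->/=|].
    by rewrite ltNge ca.
  exact: slA.
have [B [d [deB slB]]] := extreme_slice_meet U0 CF exte ca reA.
exists B, d; split => // s Fs ds i; have [cs rs] := slB s Fs ds.
by rewrite in_cons => /predU1P[->//|]; apply: slA => //; exact: ltW.
Qed.

(* A point of Gateaux differentiability of the support function of [F] exposes
   a unique point of [F]. *)
Lemma slice_extreme (U : set X) (F : set T) (A : X) (c : R) t :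
  gateaux_diff_space emb X -> nbhs 0 U -> CU U F -> F t -> c < re (t A) ->
  exists2 e, extreme_points F e & c <= re (e A).
Proof.
move=> gdX U0 CF Ft ctA.
have /choice[m mP] : forall x : X, exists s : T, F s /\
    forall u, F u -> re (u x) <= re (s x).
  move=> x; have [||s /[!inE] Fs smax] := @compact_EVT_max T R
      (fun s => re (s x)) F _ (CU_compact U0 CF); first by exists t.
    by apply: continuous_subspaceT; exact: re_eval_continuous.
  by exists s; split => // u Fu; apply: smax; rewrite inE.
pose h x := re (m x x).
have hge u x : F u -> re (u x) <= h x by move=> Fu; have [_] := mP x; apply.
have Fm x : F (m x) by have [] := mP x.
have close u x y r : F u -> 0 < r -> U (emb r *: (y - x)) ->
    `|re (u y) - re (u x)| <= r^-1.
  move=> Fu r0 Ur; rewrite -reN -reD; apply: le_trans (re_le_nrm _) _.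
  exact: polar_close (CU_polar CF Fu) r0 Ur.
have ch : continuous h.
  move=> x; apply/cvgrPdist_lt => d d0.
  apply: filterS (nbhs_scaled x (2 / d) U0) => y Uy.
  have d20 : 0 < 2 / d by rewrite divr_gt0.
  have := close _ _ _ _ (Fm x) d20 Uy; have := close _ _ _ _ (Fm y) d20 Uy.
  have := hge _ y (Fm x); have := hge _ x (Fm y); rewrite /h.
  rewrite invf_div !ler_norml ltr_norml => ? ? /andP[? ?] /andP[? ?].
  by apply/andP; split; lra.
(* The point [x] is so close to [A] that each member of [F] varies by at most half of [re (t A) - c]
   between them. Passing to [x] and back costs the whole margin, so [m x] still reaches level [c] at
   [A]. *)
have [||||x [[_ [L [Llin [_ dL]]]] Ux]] :=
    @gdX setT h _ openT _ _ _ A I _ (nbhs_scaled A (2 / (re (t A) - c)) U0).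
- by exists 0.
- by [].
- exact: continuous_subspaceT.
- move=> x y _ _ r /andP[r0 r1]; rewrite /h.
  set z := emb r *: x + _.
  have dz : dual (m z) by exact: CU_dual CF (Fm z).
  rewrite {2}/z dualD// !dualZ// re_mix lerD// ler_wpM2l//; first exact: hge.
    by rewrite subr_ge0.
  exact: hge.
have L0 : L 0 = 0.
  by have := Llin 1 0 0; rewrite scaler0 addr0 mul1r; lra.
have LN y : L (- y) = - L y.
  have := Llin (-1) y 0.
  by rewrite embN emb1 scaleN1r !addr0 L0 addr0 mulN1r.
(* The real part of [u] lies below [h] and touches it at [x], so it is bounded by the one-sided
   derivative [L]; replacing [y] by [- y] gives equality. *)
have support u : F u -> re (u x) = h x -> forall y, re (u y) = L y.
  move=> Fu ux; have du := CU_dual CF Fu.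
  have leL y : re (u y) <= L y.
    have dLy : (fun r : R => r^-1 * (h (x + emb r *: y) - h x)) @ 0^'+ --> L y.
      exact: cvg_dnbhs_at_right (dL y).
    apply: (cvgr_to_ge dLy); near=> r.
    have r0 : 0 < r by near: r; exact: nbhs_right_gt.
    rewrite ler_pdivlMl// -ux lerBrDl.
    by rewrite -reM -reD -dualZ// -dualD//; exact: hge.
  move=> y; apply/eqP; rewrite eq_le leL/=.
  by have := leL (- y); rewrite LN re_dualN// lerN2.
have c0 : 0 < 2 / (re (t A) - c) by rewrite divr_gt0// subr_gt0.
exists (m x).
  split=> // s1 s2 F1 F2 r /andP[r0 r1] mE.
  (* With positive weights, both ends of the segment must attain the maximum at [x], and [support]
     then identifies them. *)
  have e12 : h x = r * re (s1 x) + (1 - r) * re (s2 x).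
    by rewrite -re_mix /h mE.
  have [h1 h2] := (hge s1 x F1, hge s2 x F2).
  have r1' : 0 < 1 - r by rewrite subr_gt0.
  have := ler_wpM2l (ltW r0) h1; have := ler_wpM2l (ltW r1') h2 => h2' h1'.
  have e1 : re (s1 x) = h x.
    apply: (mulfI (lt0r_neq0 r0)); lra.
  have e2 : re (s2 x) = h x.
    apply: (mulfI (lt0r_neq0 r1')); lra.
  apply: contrapT => s12.
  have [B] := re_dual_neq (CU_dual CF F1) (CU_dual CF F2) s12.
  by rewrite (support _ F1 e1) (support _ F2 e2) eqxx.
have := close _ _ _ _ (Fm x) c0 Ux; have := close _ _ _ _ Ft c0 Ux.
have := hge t x Ft; rewrite /h invf_div !ler_norml.
by move=> ? /andP[? ?] /andP[? ?]; lra.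
Unshelve. all: by end_near. Qed.

(** * The countable family of open conditions *)

Section DenseSequence.
Variable a : nat -> X.
Hypothesis a_dense : forall (x : X) (B : set X), nbhs x B -> exists j, B (a j).

Definition cell (n : nat) (e : X -> K) : set T :=
  [set s | forall j, (j < n)%N -> nrm (s (a j) - e (a j)) < n.+1%:R^-1].

Lemma cell_center n e : cell n e e.
Proof. by move=> j _; rewrite subrr nrm0 invr_gt0 ltr0n. Qed.

Lemma cell_sym n e s : cell n e s -> cell n s e.
Proof. by move=> es j jn; rewrite nrmC; exact: es. Qed.

Lemma cell_open n e : open (cell n e).
Proof.
suff : forall k, open [set s : T | forall j, (j < k)%N ->
  nrm (s (a j) - e (a j)) < n.+1%:R^-1] by exact.
elim=> [|k IH]; first by rewrite (_ : mkset _ = setT);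
  [exact: openT|apply/seteqP; split].
rewrite (_ : mkset _ = [set s : T | forall j, (j < k)%N ->
  nrm (s (a j) - e (a j)) < n.+1%:R^-1] `&`
  (fun s : T => nrm (s (a k) - e (a k))) @^-1` [set r | r < n.+1%:R^-1]).
  apply: openI => //; apply: open_comp; last exact: open_lt.
  by move=> s _; exact: nrm_eval_continuous.
apply/seteqP; split => [s sP|s [sP sk] j].
  by split => [j jk|]; apply: sP => //; exact: ltnW.
by rewrite ltnS leq_eqVlt => /predU1P[->//|]; exact: sP.
Qed.

(** By equicontinuity, functionals at distance [d] at [x] each move by at most [d / 3] on a
    neighborhood of [x], so they cannot agree at a term of the sequence in it. *)
Lemma CU_neq_dense (U : set X) (F : set T) s t :
  nbhs 0 U -> CU U F -> F s -> F t -> s <> t -> exists j, s (a j) != t (a j).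
Proof.
move=> U0 CF Fs Ft st.
have [x stx] : exists x, s x != t x.
  apply: contrapT => /forallNP eqst; apply: st; apply: funext => x.
  by have /negP/negPn/eqP := eqst x.
pose d := nrm (s x - t x).
have d0 : 0 < d by rewrite nrm_gt0 subr_eq0.
have [j Uj] := a_dense (nbhs_scaled x (3 / d) U0).
exists j; apply/eqP => stj.
have d30 : 0 < 3 / d by rewrite divr_gt0.
have := polar_close (CU_polar CF Fs) d30 Uj.
have := polar_close (CU_polar CF Ft) d30 Uj.
rewrite -stj invf_div => tj; rewrite nrmC => sj.
have := nrmD (s x - s (a j)) (s (a j) - t x).
by rewrite addrA subrK -/d; lra.
Qed.

(** On the compact set [F] the dense sequence already determines the pointwise topology. The center
    [e] is arbitrary because the centers in [sliced] depend on [n]. *)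
Lemma cell_refine (U : set X) (F : set T) s (B : set T) :
  nbhs 0 U -> CU U F -> F s -> nbhs (s : T) B ->
  exists n, forall e t, F t -> cell n e s -> cell n e t -> B t.
Proof.
move=> U0 CF Fs; rewrite nbhsE => -[V [oV Vs] VB].
pose f (i : nat * nat) : set T :=
  [set t | i.2.+1%:R^-1 < nrm (t (a i.1) - s (a i.1))].
have cFV : compact (F `&` ~` V).
  by apply: compact_closedI; [exact: CU_compact CF|exact: open_closedC].
have [t [Ft Vt]|q qP] := @compact_subcover T (nat * nat)%type _ f cFV.
  have [|j tsj] := CU_neq_dense U0 CF Ft Fs.
    by move=> ts; rewrite ts in Vt.
  have d0 : 0 < nrm (t (a j) - s (a j)) by rewrite nrm_gt0 subr_eq0.
  have [k kd] : exists k : nat, k.+1%:R^-1 < nrm (t (a j) - s (a j)).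
    near \oo => k; exists k; near: k.
    exact: near_infty_natSinv_lt (PosNum d0).
  exists (j, k).
  apply: open_nbhs_nbhs; split => //.
  apply: (@open_comp _ _ (fun t : T => nrm (t (a j) - s (a j)))
    [set r | k.+1%:R^-1 < r]); last exact: open_gt.
  by move=> ? _; exact: nrm_eval_continuous.
(* The sum exceeds every [j] and every [k + k] occurring in [q]. Hence the cell radius is at most
   half of [k.+1%:R^-1], and going from [t] to [s] through [e] stays within that bound. *)
exists (\sum_(i <- q) (i.1 + (i.2 + i.2)).+1)%N => e t Ft es et.
apply: VB; apply: contrapT => Vt; have [[j k] iq] := qP t (conj Ft Vt).
rewrite /f/=; apply/negP; rewrite -leNgt.
set n := (\sum_(i <- q) _)%N in es et.
have nle : (j + (k + k) < n)%N by rewrite /n (big_rem _ iq)/= leq_addr.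
have jn : (j < n)%N by apply: leq_ltn_trans nle; exact: leq_addr.
have kn : (k + k < n)%N by apply: leq_ltn_trans nle; exact: leq_addl.
have := nrmD (t (a j) - e (a j)) (e (a j) - s (a j)).
rewrite addrA subrK => /le_trans; apply.
have nk : n.+1%:R^-1 <= k.+1%:R^-1 / 2 :> R.
  rewrite -invfM lef_pV2 ?posrE ?mulr_gt0// -natrM ler_nat.
  by rewrite muln2 -addnn addSn addnS.
rewrite [leRHS]splitr lerD//; apply: le_trans nk; apply/ltW; first exact: et.
exact: cell_sym es j jn.
Unshelve. all: by end_near. Qed.

(* The triple [(A, r, e)] stands for the cell around [e] together with the slice
   of [F] in direction [A] at level [r]; the second inclusion places the slice
   in the cell in the form "[F] is contained in an open set". *)
Definition sliced (U : set X) (n : nat) : set (set (X -> K)) :=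
  [set F | CU U F /\ exists L : seq (X * R * T),
    (forall i, i \in L ->
      (exists2 t, F t & i.1.2 < re (t i.1.1)) /\
      F `<=` cell n i.2 `|` [set t | re (t i.1.1) < i.1.2]) /\
    F `<=` [set t | exists2 i, i \in L & cell n i.2 t]].

Lemma sliced_open (U : set X) n : nbhs 0 U -> hyper_open nrm emb U (sliced U n).
Proof.
move=> U0; split => [F []//|F [CF [L [slL covL]]]].
have oL : open [set t : T | exists2 i, i \in L & cell n i.2 t].
  rewrite (_ : mkset _ = \bigcup_(i in [set i | i \in L]) cell n i.2).
    by apply: bigcup_open => i _; exact: cell_open.
  by apply/seteqP; split => [t [i iL it]|t [i iL it]]; exists i.
have near1 := hyper_near_subset U0 CF oL covL.
have near2 : hyper_near U F (fun G => forall i, i \in L ->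
      (exists2 t, G t & i.1.2 < re (t i.1.1)) /\
      G `<=` cell n i.2 `|` [set t | re (t i.1.1) < i.1.2]).
  apply: hyper_near_seq => i iL; have [[t Ft it] Fi] := slL i iL.
  apply: hyper_nearI; first exact: hyper_near_meet Ft it.
  apply: hyper_near_subset => //; apply: openU; first exact: cell_open.
  apply: (@open_comp _ _ (fun t : T => re (t i.1.1)) [set r | r < i.1.2]).
    by move=> ? _; exact: re_eval_continuous.
  exact: open_lt.
have [As [e [e0 nearA]]] := hyper_nearI near1 near2.
exists As, e; split => // G CG dG; split => //; exists L.
by have [? ?] := nearA G CG dG.
Qed.

Lemma DU_sliced (U : set X) n : nbhs 0 U -> DU nrm emb U `<=` sliced U n.
Proof.
move=> U0 F [CF FE]; split => //.
pose cond (i : X * R * T) := (exists2 t, F t & i.1.2 < re (t i.1.1)) /\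
  F `<=` cell n i.2 `|` [set t | re (t i.1.1) < i.1.2].
have [s Fs|q qP] := @compact_subcover T (X * R * T)%type F
    (fun i => [set t | cell n i.2 t /\ cond i]) (CU_compact U0 CF).
  (* An extreme point near [s] serves as center: its cell contains [s] by symmetry and a slice of
     [F] by [extreme_slice]. *)
  have [e [exte es]] : (extreme_points F `&` cell n s) !=set0.
    have [cs _] : wstar_closure (extreme_points F) s by rewrite -FE.
    apply: cs; apply: open_nbhs_nbhs.
    by split; [exact: cell_open|exact: cell_center].
  have [A [r [reA slA]]] :=
    extreme_slice U0 CF exte (cell_open n e) (@cell_center n e).
  exists (A, r, e).
  have : nbhs (s : T) (cell n e).
    by apply: open_nbhs_nbhs; split; [exact: cell_open|exact: cell_sym].
  apply: filterS => t et; split => //; split.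
    by exists e => //; have [] := exte.
  by move=> u Fu; have [/(slA u Fu)|] := leP r (re (u A)); [left|right].
(* Triples violating [cond] cover nothing, so discarding them keeps the cover. *)
exists [seq i <- q | `[< cond i >] ]; split => [i|t /qP[i iq [it ci]]].
  by rewrite mem_filter => /andP[/asboolP].
by exists i => //; rewrite mem_filter iq andbT; exact/asboolP.
Qed.

(** The cell covering [s] contains a slice of [F], hence an extreme point by [slice_extreme]; for
    the [n] of [cell_refine] that point lies in the prescribed neighborhood of [s]. *)
Lemma bigcap_sliced (U : set X) : gateaux_diff_space emb X -> nbhs 0 U ->
  \bigcap_n sliced U n `<=` DU nrm emb U.
Proof.
move=> gdX U0 F slF; have [CF _] := slF 0%N I; split => //.
apply/seteqP; split => [s Fs|s [cs _]]; last first.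
  by apply: (CU_closed U0 CF); apply: closure_subset cs => t [].
split; last exact: CU_dual CF Fs.
move=> B Bs; have [n nP] := cell_refine U0 CF Fs Bs.
have [_ [L [slL covL]]] := slF n I.
have [i iL is_] := covL s Fs; have [[t Ft it] Fi] := slL i iL.
have [e exte ie] := slice_extreme gdX U0 CF Ft it.
exists e; split => //; apply: (nP i.2) => //; first by case: exte.
by have [//|/=] := Fi e exte.1; rewrite ltNge ie.
Qed.

End DenseSequence.

Lemma DU_Gdelta (U : set X) : separable X -> gateaux_diff_space emb X ->
  nbhs 0 U -> hyper_Gdelta nrm emb U (DU nrm emb U).
Proof.
move=> [S [cS dS]] gdX U0; have [a a_dense] := dense_sequence 0 cS dS.
exists (sliced a U); split => [n|]; first exact: sliced_open.
apply/seteqP; split => [F DF n _|]; first exact: DU_sliced.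
exact: bigcap_sliced.
Qed.

End WeakStar.

(* K = R and K = C (= R[i]) *)
Theorem theorem4p9 (R : realType) :
  thm_for (R := R) (K := R) (fun x : R => `|x|) (fun r : R => r) /\
  thm_for (R := R) (K := R[i]) (fun z : R[i] => complex.Re `|z|)
          (fun r : R => (r%:C)%C).
Proof.
split=> X _ sepX _ gdX U U0.
  apply: (@DU_Gdelta R R _ _ id 0 0) => // k.
  by rewrite mul0r addr0.
apply: (@DU_Gdelta R R[i] _ _ (@complex.Re R) (- 'i)%C 'i%C) => //.
- by move=> a b; rewrite rmorphD.
- by move=> a b; rewrite rmorphM.
- by move=> a b; rewrite lecR.
- by move=> k l; rewrite raddfD.
- by move=> r [a b]; rewrite /= mul0r subr0.
- by move=> k; rewrite -lecR RRe_real ?normr_real//; exact: normc_ge_Re.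
- move=> [a b]; apply/eqP; rewrite eq_complex /=; apply/andP.
  by split; apply/eqP; ring.
Qed.
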